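(* Let $n\ge 1$ and $0\le m\le n$. Then $P_{n,m}(x)=x^nP_{n,n-m}(1/x)$, where $P_{n,m}(x)=\sum_{k=0}^{n}p_{n,m,k}x^k$. Equivalently, $p_{n,m,k}=p_{n,n-m,n-k}$ for all $k$.
   Context: A Dyck path of semilength $n\ge 0$ is a lattice path in $\mathbb{Z}\times\mathbb{Z}$ from $(0,0)$ to $(2n,0)$ using up steps $U=(1,1)$ and down steps $D=(1,-1)$; it is allowed to go below the $x$-axis. Write it as a word $P_1P_2\cdots P_{2n}$ over $\{U,D\}$. An up step is under the $x$-axis if it goes from height $-h$ to height $-h+1$ for some $h\ge 1$. A Dyck path is $(n,m)$-flawed if it has semilength $n$ and exactly $m$ up steps under the $x$-axis. A peak is a position $i$ with $P_iP_{i+1}=UD$. Let $p_{n,m,k}$ be the number of $(n,m)$-flawed paths with exactly $k$ peaks. *)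

(* Defs.v *)
From HB Require Import structures.
From mathcomp Require Import all_boot all_order all_algebra.

Set Implicit Arguments.
Unset Strict Implicit.
Unset Printing Implicit Defensive.

Import GRing.Theory.
Local Open Scope ring_scope.

Definition U : bool := true.
Definition D : bool := false.

(* Ordinate of the end point of a path from the origin; the abscissa is the
   length of the word. *)
Definition height (w : seq bool) : int :=
  \sum_(s <- w) (if s == U then 1 else -1).

(* The path may go below the x-axis: only the end point is constrained. *)
Definition is_dyck (n : nat) (w : n.*2.-tuple bool) : bool := height w == 0.

(* Step i (counted from 0) starts at height [height (take i w)]; it goes from
   -h to -h+1 for some h >= 1 iff it is U and that height is negative. *)
Definition up_under (w : seq bool) (i : nat) : bool :=
  (nth D w i == U) && (height (take i w) < 0).

Definition flaws (w : seq bool) : nat := count (up_under w) (iota 0 (size w)).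

(* A default value is never read by [nth] in [flaws] and [peaks]. *)
Definition is_peak (w : seq bool) (i : nat) : bool :=
  (nth U w i == U) && (nth U w i.+1 == D).

Definition peaks (w : seq bool) : nat :=
  count (is_peak w) (iota 0 (size w).-1).

Definition flawed_paths (n m : nat) : {set n.*2.-tuple bool} :=
  [set w | is_dyck w && (flaws w == m)].

(* The number of peaks k ranges over the integers, so that n - k is a genuine
   (not truncated) difference. *)
Definition flawed_count (n m : nat) (k : int) : nat :=
  #|[set w in flawed_paths n m | (peaks w)%:Z == k]|.

Definition flawed_poly (n m : nat) : {poly int} :=
  \poly_(k < n.+1) (flawed_count n m k%:Z)%:Z.

(* P(1/x) in the field of rational functions, x being the indeterminate. *)
Definition poly_inv_arg (P : {poly int}) : {fraction {poly int}} :=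
  (map_poly intr P).[(FracField.tofrac 'X)^-1].

(* Main.v *)
(** Cut a path at the points where it crosses the x-axis. Each block is a Dyck
    path lying on one side of the axis, hence a nonempty binary tree T through
    U A D B <-> node A B, or D A U B <-> node A B below the axis. If T has s
    nodes, e of them without left child, then the block contributes e peaks when
    it lies above the axis and e - 1 when it lies below, and no peak straddles
    two blocks. Of the s + 1 empty subtrees of T, e are left ones and s + 1 - e
    are right ones, so mirroring every tree while moving every block to the
    other side of the axis turns k peaks into n - k and m flaws into n - m. *)

Require Import Defs.
From mathcomp Require Import all_boot all_order all_algebra.
From mathcomp Require Import zify.
Import GRing.Theory.
Local Open Scope ring_scope.

(** * Binary trees and their mirror images *)

Inductive btree : Type := leaf | node of btree & btree.

Definition is_leaf (t : btree) : bool := if t is leaf then true else false.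

Fixpoint nodes (t : btree) : nat :=
  if t is node l r then (nodes l + nodes r).+1 else 0.

Fixpoint left_leaves (t : btree) : nat :=
  if t is node l r then (is_leaf l + left_leaves l + left_leaves r)%N else 0.

Fixpoint mirror (t : btree) : btree :=
  if t is node l r then node (mirror r) (mirror l) else leaf.

Lemma mirrorK : involutive mirror.
Proof. by elim=> //= l -> r ->. Qed.

Lemma is_leaf_mirror t : is_leaf (mirror t) = is_leaf t.
Proof. by case: t. Qed.

Lemma nodes_mirror t : nodes (mirror t) = nodes t.
Proof. by elim: t => //= l -> r ->; rewrite addnC. Qed.

(** Left empty subtrees of [mirror t] are right ones of [t]. A bare [leaf] is the child of no node
    and counts for nothing, whence the last term. *)
Lemma left_leaves_mirror t :
  (left_leaves t + left_leaves (mirror t) = nodes t + ~~ is_leaf t)%N.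
Proof.
elim: t => //= l IHl r IHr; rewrite is_leaf_mirror.
by case: (is_leaf l) (is_leaf r) IHl IHr => [] [] /=; lia.
Qed.

(** * Paths read off from trees and sequences of trees *)

(** [b] is the opening letter: [U] above the axis, [D] below. *)
Fixpoint block (b : bool) (t : btree) : seq bool :=
  if t is node l r then b :: block b l ++ ~~ b :: block b r else [::].

Fixpoint blocks (b : bool) (s : seq btree) : seq bool :=
  if s is t :: s' then block b t ++ blocks (~~ b) s' else [::].

(** Empty blocks would blur the alternation of sides; without them the decomposition is unique. *)
Definition no_leaf (s : seq btree) : bool := all (fun t => ~~ is_leaf t) s.

Definition total_nodes (s : seq btree) : nat := sumn (map nodes s).

Lemma no_leaf_mirror s : no_leaf (map mirror s) = no_leaf s.
Proof. by elim: s => //= t s; rewrite /no_leaf /= is_leaf_mirror => ->. Qed.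

Lemma size_block b t : size (block b t) = (nodes t).*2.
Proof. by elim: t => //= l IHl r IHr; rewrite size_cat /= IHl IHr; lia. Qed.

Lemma size_blocks b s : size (blocks b s) = (total_nodes s).*2.
Proof.
elim: s b => //= t s IH b.
by rewrite size_cat IH size_block /total_nodes /= doubleD.
Qed.

Lemma total_nodes_mirror s : total_nodes (map mirror s) = total_nodes s.
Proof. by elim: s => //= t s; rewrite /total_nodes /= nodes_mirror => ->. Qed.

Lemma height_nil : height [::] = 0.
Proof. by rewrite /height big_nil. Qed.

Lemma height_cons x w : height (x :: w) = (if x then 1 else -1) + height w.
Proof. by rewrite /height big_cons; case: x. Qed.

Lemma height_cat v w : height (v ++ w) = height v + height w.
Proof. by rewrite /height big_cat. Qed.

Lemma height_block b t : height (block b t) = 0.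
Proof.
elim: t => [|l IHl r IHr] /=; first exact: height_nil.
by rewrite height_cons height_cat height_cons IHl IHr; case: (b) => /=; lia.
Qed.

Lemma height_blocks b s : height (blocks b s) = 0.
Proof.
elim: s b => [|t s IH] b /=; first exact: height_nil.
by rewrite height_cat height_block IH.
Qed.

(** * Flaws of a block and of its mirror image *)

Fixpoint flaws_from (h : int) (w : seq bool) : nat :=
  if w is x :: w' then
    ((x && (h < 0)%R) + flaws_from (h + (if x then 1 else -1))%R w')%N
  else 0.

Lemma flaws_fromE w : flaws w = flaws_from 0 w.
Proof.
(* Removing the first letter shifts all later heights, hence the offset [h]. *)
have gen h : count (fun i => (nth D w i == U) && (h + height (take i w) < 0))
               (iota 0 (size w)) = flaws_from h w.
  elim: w h => //= x w IH h.
  rewrite height_nil addr0; congr (_ + _)%N; first by case: x.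
  rewrite (iotaDl 1 0) count_map -IH; apply: eq_count => i /=.
  by rewrite height_cons addrA.
by rewrite -gen; apply: eq_count => i; rewrite add0r.
Qed.

Lemma flaws_from_cat h v w :
  flaws_from h (v ++ w) = (flaws_from h v + flaws_from (h + height v) w)%N.
Proof.
elim: v h => [|x v IH] h /=; first by rewrite height_nil addr0.
by rewrite IH height_cons addrA addnA.
Qed.

Lemma flaws_from_up h t : 0 <= h -> flaws_from h (block true t) = 0%N.
Proof.
elim: t h => //= l IHl r IHr h h0.
rewrite flaws_from_cat /= height_block IHl; last by lia.
by rewrite IHr; lia.
Qed.

(** Each node owns one up step, which ends at height at most [h] and so starts below 0. *)
Lemma flaws_from_down h t : h <= 0 -> flaws_from h (block false t) = nodes t.
Proof.
elim: t h => //= l IHl r IHr h h0.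
rewrite flaws_from_cat /= height_block IHl; last by lia.
by rewrite IHr; lia.
Qed.

Lemma flaws_blocks_mirror b s :
  (flaws_from 0 (blocks b s) + flaws_from 0 (blocks (~~ b) (map mirror s))
   = total_nodes s)%N.
Proof.
elim: s b => //= t s IH b.
rewrite !flaws_from_cat !height_block addr0 /total_nodes /= -/(total_nodes s).
rewrite -(IH (~~ b)).
by case: b => /=; rewrite flaws_from_up // flaws_from_down // ?nodes_mirror; lia.
Qed.

(** * Peaks of a block and of its mirror image *)

(* [c] is the letter preceding [w]; [D] stands for the absence of one. *)
Fixpoint peaks_after (c : bool) (w : seq bool) : nat :=
  if w is x :: w' then ((c && ~~ x) + peaks_after x w')%N else 0.

Lemma peaks_afterE w : peaks w = peaks_after D w.
Proof.
have gen c v : count (is_peak (c :: v)) (iota 0 (size v)) = peaks_after c v.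
  elim: v c => //= x v IH c; congr (_ + _)%N; first by case: c; case: x.
  by rewrite (iotaDl 1 0) count_map -IH; apply: eq_count.
by case: w => //= x w; rewrite -gen.
Qed.

Lemma peaks_after_cat c v w :
  peaks_after c (v ++ w) = (peaks_after c v + peaks_after (last c v) w)%N.
Proof. by elim: v c => //= x v IH c; rewrite IH addnA. Qed.

Lemma last_block c b t : last c (block b t) = if is_leaf t then c else ~~ b.
Proof.
elim: t c => //= l _ r IHr c; rewrite last_cat /= IHr.
by case: (is_leaf r).
Qed.

(** The [D] closing a node follows a [U] exactly when the left subtree is empty, as a nonempty upper
    block ends with [D]. *)
Lemma peaks_after_up c t : peaks_after c (block true t) = left_leaves t.
Proof.
elim: t c => //= l IHl r IHr c.
rewrite peaks_after_cat /= IHl IHr last_block.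
by case: (is_leaf l); case: c => /=; lia.
Qed.

(** Here a peak is the [U] of a node with nonempty right subtree, or a preceding [c = U] before a
    nonempty block. The additive form avoids truncated subtraction. *)
Lemma peaks_after_down c t :
  (peaks_after c (block false t) + ~~ is_leaf t
   = left_leaves t + (c && ~~ is_leaf t))%N.
Proof.
elim: t c => [|l IHl r IHr] c /=; first by rewrite andbF.
rewrite peaks_after_cat /= last_block.
move: (IHl false) (IHr true).
by case: (is_leaf l); case: (is_leaf r); case: c => /=; lia.
Qed.

(** The conditions on [c] and [c'] forbid a [U] just before a lower block, so no peak straddles a
    border. *)
Lemma peaks_blocks_mirror b c c' s : no_leaf s -> b || ~~ c -> ~~ b || ~~ c' ->
  (peaks_after c (blocks b s) + peaks_after c' (blocks (~~ b) (map mirror s))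
   = total_nodes s)%N.
Proof.
elim: s b c c' => //= t s IH b c c' /andP[tN sN] bc bc'.
rewrite !peaks_after_cat !last_block is_leaf_mirror (negPf tN).
rewrite /total_nodes /= -/(total_nodes s).
(* The new preceding letters are the last letters of the two blocks just read. *)
rewrite -(IH (~~ b) (~~ b) (~~ ~~ b)) //; try by case: (b).
move: (left_leaves_mirror t) (peaks_after_down c t)
  (peaks_after_down c' (mirror t)).
rewrite is_leaf_mirror (negPf tN) /=.
case: b bc bc' => /= bc bc'; rewrite peaks_after_up.
  by rewrite (negPf bc') /=; lia.
by rewrite (negPf bc) /=; lia.
Qed.

(** * Uniqueness of the decomposition into blocks *)

Definition starts_with (b : bool) (w : seq bool) : bool :=
  if w is x :: _ then x == b else false.

Lemma starts_with_blocks b s : starts_with (~~ b) (blocks b s) -> ~~ no_leaf s.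
Proof. by case: s => //= -[|l r] s //=; case: b. Qed.

(** A letter [b] always opens a further node, so the block ends where [b] fails to follow; a left
    subtree is delimited likewise by its closing [~~ b]. *)
Lemma block_cat_inj b t t' v v' :
    ~~ starts_with b v -> ~~ starts_with b v' ->
  block b t ++ v = block b t' ++ v' -> t = t' /\ v = v'.
Proof.
have bNb : ~~ (~~ b == b) by case: (b).
elim: t t' v v' => [|l IHl r IHr] [|l' r'] v v' /= vb v'b e //.
- by rewrite e /= eqxx in vb.
- by rewrite -e /= eqxx in v'b.
case: e; rewrite -!catA !cat_cons => e.
have [||-> [e']] := IHl _ _ _ _ _ e; rewrite ?bNb //.
by have [-> ->] := IHr _ _ _ vb v'b e'.
Qed.

Lemma blocks_inj b b' s s' : no_leaf s -> no_leaf s' -> s <> [::] ->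
  blocks b s = blocks b' s' -> b = b' /\ s = s'.
Proof.
move=> sN s'N s0 e; have eb : b = b'.
  case: s s' sN s'N s0 e => [//|[//|l r] s] [|[//|l' r'] s'] //= _ _ _.
  by case.
split=> //; rewrite -{}eb {b' s0} in e.
have nst c u : no_leaf u -> ~~ starts_with c (blocks (~~ c) u).
  by move=> uN; apply: contraL uN => h; apply: (starts_with_blocks (~~ c)); rewrite negbK.
elim: s s' b sN s'N e => [|t s IH] [|t' s'] b //=.
- by case: t' => //= l r _ /andP[].
- by case: t => //= l r /andP[].
case/andP=> _ sN /andP[_ s'N] e.
have [-> e'] := block_cat_inj _ _ _ _ _ (nst b _ sN) (nst b _ s'N) e.
by rewrite (IH _ _ sN s'N e').
Qed.

(** * Existence of the decomposition *)

(* If the rest [v] does start with [b], then that step is never matched, so that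
   [v] ends on the [b] side of its starting level. *)
Lemma block_prefix b w :
  {t : btree & {v : seq bool | w = block b t ++ v &
    starts_with b v -> 0 < (if b then height v else - height v)}}.
Proof.
have [k] := ubnP (size w); elim: k w => // k IH [|x w] /= wk.
  by exists leaf, [::].
have [xb|xb] := eqVneq x b; last first.
  by exists leaf, (x :: w) => //=; rewrite (negPf xb).
rewrite {}xb; case: (IH w wk) => l [v ew hv].
have hw : height w = height v by rewrite ew height_cat height_block add0r.
case: v => [|y v] in ew hv hw *.
  (* The opening step is never closed: the empty tree is split off. *)
  exists leaf, (b :: w) => //= _; move: hw.
  by rewrite height_cons height_nil => ->; case: (b).
have [yb|yb] := eqVneq y b.
  exists leaf, (b :: w) => //= _; rewrite height_cons hw.
  by move: hv; rewrite yb /= eqxx => /(_ isT); case: (b) => /=; lia.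
have {}yb : y = ~~ b by case: (y) (b) yb => [] [].
rewrite {}yb in ew hv hw.
have vk : (size v < k)%N by move: wk; rewrite ew size_cat /=; lia.
case: (IH v vk) => r [u ev hu].
by exists (node l r), u => //=; rewrite ew ev -catA.
Qed.

Lemma blocks_surj w : height w = 0 ->
  {b : bool & {s : seq btree | no_leaf s & w = blocks b s}}.
Proof.
move=> w0; suff [s sN ->] : {s | no_leaf s & w = blocks (head D w) s}.
  by exists (head D w), s.
have : ~~ starts_with (~~ head D w) w by case: (w) => //= -[].
move: (head D w) => b; have [k] := ubnP (size w).
elim: k w w0 b => // k IH [|x w] w0 b wk wb; first by exists [::].
case: (block_prefix b (x :: w)) => t [v ew hv].
have v0 : height v = 0 by rewrite -w0 ew height_cat height_block add0r.
(* An unmatched [b] would leave the rest at nonzero height. *)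
have vb : ~~ starts_with b v.
  by apply/negP => /hv; rewrite v0; case: (b).
case: t => [|l r] in ew *.
  by move: ew vb wb => /= <- /=; case: (x) (b) => [] [].
have vk : (size v < k)%N.
  by have := congr1 size ew; move: wk; rewrite /= size_cat /= => ? ?; lia.
have [|s sN ev] := IH v v0 (~~ b) vk; first by rewrite negbK.
by exists (node l r :: s) => //=; rewrite -ev.
Qed.

(** * The duality on words of height 0 *)

Lemma dual_path w : {w' : seq bool | height w = 0 ->
  exists b s, [/\ no_leaf s, w = blocks b s & w' = blocks (~~ b) (map mirror s)]}.
Proof.
have [/blocks_surj[b [s sN ->]]|w0] := eqVneq (height w) 0.
  by exists (blocks (~~ b) (map mirror s)) => _; exists b, s.
by exists w => /eqP; rewrite (negPf w0).
Qed.

Definition dual w : seq bool := sval (dual_path w).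

Lemma dualP w : height w = 0 ->
  exists b s, [/\ no_leaf s, w = blocks b s & dual w = blocks (~~ b) (map mirror s)].
Proof. exact: (svalP (dual_path w)). Qed.

Lemma size_dual w : height w = 0 -> size (dual w) = size w.
Proof.
by move=> /dualP[b [s [_ -> ->]]]; rewrite !size_blocks total_nodes_mirror.
Qed.

Lemma height_dual w : height w = 0 -> height (dual w) = 0.
Proof. by move=> /dualP[b [s [_ _ ->]]]; rewrite height_blocks. Qed.

Lemma flaws_dual w : height w = 0 -> (flaws w + flaws (dual w))%N = (size w)./2.
Proof.
move=> /dualP[b [s [_ -> ->]]].
by rewrite !flaws_fromE flaws_blocks_mirror size_blocks doubleK.
Qed.

Lemma peaks_dual w : height w = 0 -> (peaks w + peaks (dual w))%N = (size w)./2.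
Proof.
move=> /dualP[b [s [sN -> ->]]].
by rewrite !peaks_afterE peaks_blocks_mirror ?orbT // size_blocks doubleK.
Qed.

Lemma dual_inj v w : height v = 0 -> height w = 0 -> dual v = dual w -> v = w.
Proof.
move=> v0 w0 e.
have ew : size w = size v by rewrite -(size_dual _ w0) -e size_dual.
(* The empty word determines no side [b], so it is settled by size. *)
have [v1|v1] := eqVneq v [::]; first by rewrite v1 in ew *; case: (w) ew.
move: e; have [b [s [sN ev ->]]] := dualP _ v0.
have [b' [s' [s'N -> ->]]] := dualP _ w0.
case/blocks_inj; rewrite ?no_leaf_mirror //.
  by case: s {sN} ev => // ev; rewrite ev in v1.
by move=> /negb_inj <- /(inj_map (inv_inj mirrorK)) <-.
Qed.

(** * Counting, and passage to the polynomials *)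

(** [dual] is an injection between the two sets; the same bound at [n - m] and [n - k] will give the
    converse. *)
Lemma flawed_count_le (n m : nat) (k : int) : (m <= n)%N ->
  (flawed_count n m k <= flawed_count n (n - m) (n%:Z - k))%N.
Proof.
(* The default [w] of [insubd] is never reached on a Dyck path, where [dual] keeps the size. *)
move=> mn; pose f (w : n.*2.-tuple bool) := insubd w (dual w) : n.*2.-tuple bool.
have fE (w : n.*2.-tuple bool) : height w = 0 -> f w = dual w :> seq bool.
  by move=> w0; rewrite val_insubd size_dual // size_tuple eqxx.
rewrite /flawed_count -(card_in_imset (f := f)); last first.
  move=> v w; rewrite !inE => /andP[/andP[/eqP v0 _] _] /andP[/andP[/eqP w0 _] _].
  by move=> /(congr1 val) /=; rewrite !fE // => /(dual_inj _ _ v0 w0)/val_inj.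
apply/subset_leq_card/subsetP => _ /imsetP[w + ->].
rewrite !inE => /andP[/andP[/eqP w0 /eqP mw] /eqP kw].
have := flaws_dual _ w0; have := peaks_dual _ w0.
rewrite size_tuple doubleK mw => kE mE.
rewrite /is_dyck fE // height_dual // eqxx /=; apply/andP; split; apply/eqP; first by lia.
by rewrite -kw -(congr1 Posz kE) PoszD addrC addKr.
Qed.

Lemma flawed_count_reciprocity (n m : nat) (k : int) : (m <= n)%N ->
  flawed_count n m k = flawed_count n (n - m) (n%:Z - k).
Proof.
move=> mn; apply/eqP; rewrite eqn_leq flawed_count_le //=.
have := flawed_count_le n (n - m) (n%:Z - k) (leq_subr _ _).
by rewrite subKn // subKr.
Qed.

Theorem theorem2p2 (n m : nat) (hn : (1 <= n)%N) (hm : (m <= n)%N) :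
  FracField.tofrac (flawed_poly n m) =
    FracField.tofrac 'X ^+ n * poly_inv_arg (flawed_poly n (n - m))
  /\ (forall k : int,
        flawed_count n m k = flawed_count n (n - m) (n%:Z - k)).
Proof.
split=> [|k]; last exact: flawed_count_reciprocity.
have X0 : FracField.tofrac ('X : {poly int}) != 0.
  by rewrite tofrac_eq0 polyX_eq0.
rewrite /poly_inv_arg (@horner_coef_wide _ n.+1); last first.
  by rewrite (leq_trans (size_poly _ _)) ?size_poly.
(* Reversing the index pairs the term of degree [n - i] on the left with the one of index [i] on the
   right. *)
rewrite /flawed_poly poly_def rmorph_sum mulr_sumr (reindex_inj rev_ord_inj) /=.
apply: eq_bigr => i _; rewrite subSS coef_map coef_poly ltn_ord /=.
have ni : (i <= n)%N by rewrite -ltnS.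
rewrite flawed_count_reciprocity // -subzn // subKr.
rewrite -mul_polyC rmorphM rmorphXn /= exprVn expfB_cond ?(negPf X0) //.
by rewrite mulrCA -[in LHS](intz (Posz _)) !rmorph_int.
Qed.
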